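(* Let $X$ be an AM-space with order unit $e$, let $Y$ be a Banach lattice, let $T\in\mathcal{L}(X,Y)$, let $\mathcal{I},\mathcal{J}$ be ideals on $\omega$, and let $A=(A_{n,k}:n,k\in\omega)$ be a matrix of positive linear operators in $\mathcal{L}(X,Y)$ such that $\lim_k\|A_{n,\ge k}\|=0$ for all $n\in\omega$. Then $A$ is $(\mathcal{I},\mathcal{J})$-regular with respect to $T$ if and only if: (T1) $\sup_n\|A_{n,\omega}\|<\infty$; (T4) $\mathcal{J}\text{-}\lim_n\sum_kA_{n,k}=T$; (T6) $\mathcal{J}\text{-}\lim_n\|A_{n,E}\|=0$ for all $E\in\mathcal{I}$.
   Context: $\omega$ is the set of nonnegative integers. An ideal on $\omega$ is a family of subsets of $\omega$ closed under subsets and finite unions; every ideal is assumed to contain all finite sets and to differ from the power set of $\omega$. $\mathcal{I}\text{-}\lim_nx_n=\eta$ means $\{n:x_n\notin U\}\in\mathcal{I}$ for every neighborhood $U$ of $\eta$ (also for $[0,\infty]$-valued sequences). For a Banach space $V$, $c^b(V,\mathcal{I})$ is the space of norm-bounded $\mathcal{I}$-convergent sequences in $V$. All Banach spaces are real. An AM-space is a Banach space $V$ that is also a vector lattice such that $0\le x\le y$ implies $\|x\|\le\|y\|$, and $\|x\vee y\|=\max\{\|x\|,\|y\|\}$ for all $x,y\ge0$. An element $e\in V$ is an order unit if for every $x\in V$ there is $n\in\omega$ with $-ne\le x\le ne$. A linear operator $S$ between vector lattices is positive if $Sx\ge0$ whenever $x\ge0$. $\mathcal{L}(X,Y)$ is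 the space of all (not necessarily bounded) linear operators $X\to Y$, with the strong operator topology. For $E\subseteq\omega$, the group norm is $\|A_{n,E}\|=\sup\{\|\sum_{k\in F}A_{n,k}x_k\|:F\subseteq E\text{ finite},\ x_k\in X,\ \|x_k\|\le1\}\in[0,\infty]$; $A_{n,\ge k}=A_{n,\{k,k+1,\dots\}}$. $A\boldsymbol{x}=(A_n\boldsymbol{x})_n$, $A_n\boldsymbol{x}=\sum_kA_{n,k}x_k$, provided each series converges in norm. $A\in(\mathscr{A},\mathscr{B})$ means that $A\boldsymbol{x}$ is well defined and in $\mathscr{B}$ for every $\boldsymbol{x}\in\mathscr{A}$. $A$ is $(\mathcal{I},\mathcal{J})$-regular with respect to $T$ if $A\in(c^b(X,\mathcal{I}),c^b(Y,\mathcal{J}))$ and $\mathcal{J}\text{-}\lim A\boldsymbol{x}=T(\mathcal{I}\text{-}\lim\boldsymbol{x})$ for all $\boldsymbol{x}\in c^b(X,\mathcal{I})$. $\mathcal{J}\text{-}\lim_n\sum_kA_{n,k}=T$ means: for all $x\in X$ and $n\in\omega$ the series $\sum_kA_{n,k}x$ converges in norm, and $\mathcal{J}\text{-}\lim_n\sum_kA_{n,k}x=Tx$ for all $x\in X$. *)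

(* Defs.v *)
From HB Require Import structures.
From mathcomp Require Import all_boot all_order all_algebra finmap.
From mathcomp Require Import all_classical all_reals all_analysis.

Set Implicit Arguments.
Unset Strict Implicit.
Unset Printing Implicit Defensive.

Import Order.TTheory GRing.Theory Num.Theory.
Import numFieldNormedType.Exports.

Local Open Scope classical_set_scope.
Local Open Scope ring_scope.

(* The order data are fields of the mixin, and the library's lattice structure
   is instantiated from them below: HB rejects a join of Order.Lattice with
   GRing.Lmodule or NormedModule, since number structures inherit from both
   hierarchies. *)
HB.mixin Record isVectorLattice (R : realType) V of GRing.Lmodule R V := {
  vle : rel V;
  vmeet : V -> V -> V;
  vjoin : V -> V -> V;
  vle_refl : reflexive vle;
  vle_anti : antisymmetric vle;
  vle_trans : transitive vle;
  vle_meet : forall x y z, vle x (vmeet y z) = vle x y && vle x z;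
  vjoin_le : forall x y z, vle (vjoin x y) z = vle x z && vle y z;
  vle_add2r : forall z x y, vle x y -> vle (x + z) (y + z);
  vle_scale_ge0 : forall (a : R) x, 0 <= a -> vle 0 x -> vle 0 (a *: x)
}.

#[short(type="banachVectorLatticeType")]
HB.structure Definition BanachVectorLattice (R : realType) :=
  {V of CompleteNormedModule R V & isVectorLattice R V}.

HB.instance Definition _ (R : realType) (V : banachVectorLatticeType R) :=
  Order.Le_isPOrder.Build ring_display (BanachVectorLattice.sort V)
    (@vle_refl R V) (@vle_anti R V) (@vle_trans R V).

HB.instance Definition _ (R : realType) (V : banachVectorLatticeType R) :=
  Order.POrder_MeetJoin_isLattice.Build ring_display
    (BanachVectorLattice.sort V) (@vle_meet R V) (@vjoin_le R V).

Definition vabs (R : realType) (V : banachVectorLatticeType R) (x : V) : V :=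
  Order.join x (- x).

Definition banach_lattice (R : realType) (V : banachVectorLatticeType R) :
    Prop :=
  forall x y : V, vabs x <= vabs y -> `|x| <= `|y|.

(* The norm is only required to be monotone on the positive cone: equality of
   the norms of x and of its absolute value is not part of the definition. *)
Definition am_space (R : realType) (V : banachVectorLatticeType R) : Prop :=
  (forall x y : V, 0 <= x -> x <= y -> `|x| <= `|y|) /\
  (forall x y : V, 0 <= x -> 0 <= y ->
     `|Order.join x y| = Num.max `|x| `|y|).

Definition order_unit (R : realType) (V : banachVectorLatticeType R) (e : V) :
    Prop :=
  forall x : V, exists n : nat, - (e *+ n) <= x /\ x <= e *+ n.

Definition positive_operator (R : realType) (V W : banachVectorLatticeType R)
    (S : V -> W) : Prop :=
  forall x : V, 0 <= x -> 0 <= S x.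

Record ideal_on_nat (I : set (set nat)) : Prop := {
  ideal_sub : forall A B : set nat, I B -> A `<=` B -> I A;
  ideal_setU : forall A B : set nat, I A -> I B -> I (A `|` B);
  ideal_finite : forall A : set nat, finite_set A -> I A;
  ideal_proper : I <> setT
}.

Definition ideal_lim (T : topologicalType) (I : set (set nat)) (x : nat -> T)
    (eta : T) : Prop :=
  forall U : set T, nbhs eta U -> I [set n | ~ U (x n)].

Definition cb (R : realType) (V : completeNormedModType R)
    (I : set (set nat)) : set (nat -> V) :=
  [set x | bounded_fun x /\ exists eta : V, ideal_lim I x eta].

Section Matrices.
Variables (R : realType) (X Y : completeNormedModType R).
Implicit Types A : nat -> nat -> {linear X -> Y}.

Definition group_norm A (n : nat) (E : set nat) : \bar R :=
  ereal_sup [set r : \bar R | exists (F : {fset nat}) (x : nat -> X),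
    [/\ [set` F] `<=` E, forall k, `|x k| <= 1
      & r = (`|\sum_(k <- F) A n k (x k)|)%:E]].

Definition mx_series A (x : nat -> X) (n : nat) : nat -> Y :=
  series (fun k => A n k (x k)).

Definition mx_apply A (x : nat -> X) : nat -> Y :=
  fun n => limn (mx_series A x n).

Definition matrix_class A (S : set (nat -> X)) (S' : set (nat -> Y)) : Prop :=
  forall x, S x -> (forall n, cvgn (mx_series A x n)) /\ S' (mx_apply A x).

Definition regular (I J : set (set nat)) (T : {linear X -> Y}) A : Prop :=
  matrix_class A (cb I) (cb J) /\
  forall (x : nat -> X) (eta : X), cb I x -> ideal_lim I x eta ->
    ideal_lim J (mx_apply A x) (T eta).

Definition ideal_lim_row_sums (J : set (set nat)) A (T : {linear X -> Y}) :
    Prop :=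
  (forall (x : X) (n : nat), cvgn (series (fun k => A n k x))) /\
  forall x : X, ideal_lim J (fun n => limn (series (fun k => A n k x))) (T x).

End Matrices.

(* Main.v *)
Require Import Defs.
From HB Require Import structures.
From mathcomp Require Import all_boot all_order all_algebra finmap.
From mathcomp Require Import all_classical all_reals all_analysis.
From mathcomp Require Import ring.

Set Implicit Arguments.
Unset Strict Implicit.
Unset Printing Implicit Defensive.

Import Order.TTheory GRing.Theory Num.Theory.
Import numFieldNormedType.Exports.

Local Open Scope classical_set_scope.
Local Open Scope ring_scope.

(** The content of the equivalence is that, for positive operators on an
    AM-space with order unit [e], the group norm [‖A_(n,E)‖] is controlled by
    one vector: the series [∑_(k ∈ E) A_(n,k) e].

    Since [X] is complete, there is a constant [C] such that [‖x‖ ≤ 1] implies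
    [-Ce ≤ x ≤ Ce] ([order_unit_norm_bound]).  Positivity of the operators then
    gives [|∑_(k ∈ F) A_(n,k) x_k| ≤ C ∑_(k ∈ E) A_(n,k) e] for every finite
    [F ⊆ E] and all [x_k] in the unit ball, hence
    [‖A_(n,E)‖ ≤ C ‖∑_(k ∈ E) A_(n,k) e‖] ([group_norm_le_mx_apply]).  For a
    regular matrix, applying this to [E = ω] turns boundedness of the transform
    of the constant sequence [e] into the uniform bound on the group norms, and
    applying it to [E ∈ I] turns the fact that the sequence [e 1_E] is
    [I]-convergent to [0] into the vanishing of the group norms along [J].  The
    condition on the row sums is regularity on constant sequences.

    The converse is an argument in Banach spaces ([regular_of_group_norm]).  The
    tail condition makes the series converge on bounded sequences.  If
    [x] is [I]-convergent to [η], the terms of [η - x] are small outside a set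
    [E ∈ I] and bounded on [E], so that [∑ A_(n,k) (η - x_k)] is at most a
    bound times [‖A_(n,E)‖] plus a small number times [‖A_(n,ω)‖].

    The delicate point is the constant [C].  It comes from a gliding hump: if
    there were none, one could sum positive vectors of the unit ball that are
    less and less dominated by [e].  This needs the positive cone to be closed,
    which is not immediate, as the AM condition relates only norms of positive
    vectors.  It is enough that [‖x⁺‖ ≤ ‖x‖], which the AM condition forces
    ([norm_pospart_am]). *)

(** * Ordered vector space computations *)

Lemma vlerD2r (R : realType) (V : banachVectorLatticeType R) (z x y : V) :
  (x + z <= y + z) = (x <= y).
Proof.
apply/idP/idP; last exact: vle_add2r.
by move/(@vle_add2r R V (- z)); rewrite !addrK.
Qed.

Lemma vlerD (R : realType) (V : banachVectorLatticeType R) (x y u v : V) :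
  x <= y -> u <= v -> x + u <= y + v.
Proof.
move=> xy uv; apply: (@le_trans _ _ (y + u)); first by rewrite vlerD2r.
by rewrite ![y + _]addrC vlerD2r.
Qed.

Lemma vsubr_ge0 (R : realType) (V : banachVectorLatticeType R) (x y : V) :
  (0 <= y - x) = (x <= y).
Proof. by rewrite -[in LHS](vlerD2r x) add0r subrK. Qed.

Lemma vlerBlDr (R : realType) (V : banachVectorLatticeType R) (x y z : V) :
  (x - y <= z) = (x <= z + y).
Proof. by rewrite -[in LHS](vlerD2r y) subrK. Qed.

Lemma vlerN2 (R : realType) (V : banachVectorLatticeType R) (x y : V) :
  (- x <= - y) = (y <= x).
Proof. by rewrite -(vsubr_ge0 (- x)) opprK addrC vsubr_ge0. Qed.

Lemma vlerZ (R : realType) (V : banachVectorLatticeType R) (a : R) (x y : V) :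
  0 <= a -> x <= y -> a *: x <= a *: y.
Proof.
move=> a0; rewrite -vsubr_ge0 -(vsubr_ge0 (a *: x)) -scalerBr.
exact: vle_scale_ge0.
Qed.

Lemma vlerZ2 (R : realType) (V : banachVectorLatticeType R) (a b : R) (x : V) :
  a <= b -> 0 <= x -> a *: x <= b *: x.
Proof.
move=> ab x0; rewrite -vsubr_ge0 -scalerBl; apply: vle_scale_ge0 => //.
by rewrite subr_ge0.
Qed.

Lemma vsumr_le (R : realType) (V : banachVectorLatticeType R) (I : Type)
    (s : seq I) (P : pred I) (f g : I -> V) :
  (forall i, P i -> f i <= g i) ->
  \sum_(i <- s | P i) f i <= \sum_(i <- s | P i) g i.
Proof.
by move=> fg; elim/big_ind2: _ => // *; exact: vlerD.
Qed.

Lemma vsumr_ge0 (R : realType) (V : banachVectorLatticeType R) (I : Type)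
    (s : seq I) (P : pred I) (f : I -> V) :
  (forall i, P i -> 0 <= f i) -> 0 <= \sum_(i <- s | P i) f i.
Proof.
by move=> f0; elim/big_rec: _ => // i y Pi y0; rewrite -[0]addr0 vlerD ?f0.
Qed.

Lemma vneg_part (R : realType) (V : banachVectorLatticeType R) (x : V) :
  Order.join (- x) 0 = Order.join x 0 - x.
Proof.
apply/le_anti/andP; split.
  rewrite leUx vsubr_ge0 leUl andbT.
  by rewrite -(vlerD2r x) addNr subrK leUr.
rewrite -(vlerD2r x) subrK leUx; apply/andP; split.
  by rewrite -{1}[x]add0r vlerD2r leUr.
by rewrite -(vlerD2r (- x)) add0r addrK leUl.
Qed.

(** Disjointness of the positive and negative parts survives rescaling one of
    them: below both [M x⁺] and [x⁻ ≤ M x⁻] means, after division by [M], below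
    both [x⁺] and [x⁻ = x⁺ - x]. *)
Lemma vdisjoint_parts (R : realType) (V : banachVectorLatticeType R) (M : R)
    (x w : V) : 1 <= M ->
  w <= M *: Order.join x 0 -> w <= Order.join (- x) 0 -> w <= 0.
Proof.
move=> M1; set a := Order.join x 0; set b := Order.join (- x) 0 => wa wb.
have b0 : 0 <= b by exact: leUr.
have bE : b = a - x by exact: vneg_part.
have M_gt0 : 0 < M by apply: lt_le_trans M1.
have Mv : 0 <= M^-1 by rewrite invr_ge0 ltW.
have wMb : w <= M *: b.
  by apply: le_trans wb _; rewrite -{1}[b]scale1r vlerZ2.
have va : M^-1 *: w <= a.
  by rewrite -[a]scale1r -(mulVf (lt0r_neq0 M_gt0)) -scalerA vlerZ.
have vb : M^-1 *: w <= a - x.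
  by rewrite -bE -[b]scale1r -(mulVf (lt0r_neq0 M_gt0)) -scalerA vlerZ.
have av : a <= a - M^-1 *: w.
  rewrite {1}/a leUx vsubr_ge0 va andbT -vsubr_ge0.
  by rewrite addrAC vsubr_ge0.
have v0 : M^-1 *: w <= 0.
  by rewrite -vlerN2 oppr0 -(vlerD2r a) add0r addrC.
rewrite -[w]scale1r -(mulfV (lt0r_neq0 M_gt0)) -scalerA -(scaler0 _ M).
by apply: vlerZ => //; exact: ltW.
Qed.

(** * The norm and the order unit of an AM-space *)

(** Test the triangle inequality on [x] and [y = M x⁺ + x⁻] with [M] large.  By
    disjointness [y = M x⁺ ∨ x⁻], so that the AM condition gives
    [‖y‖ = M ‖x⁺‖], while [x + y = (M + 1) x⁺]; the difference of the two norms
    is [‖x⁺‖]. *)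
Lemma norm_pospart_am (R : realType) (V : banachVectorLatticeType R) (x : V) :
  am_space V -> `|Order.join x 0| <= `|x|.
Proof.
move=> [Vmono Vmax].
set a := Order.join x 0; set b := Order.join (- x) 0.
have a0 : 0 <= a by exact: leUr.
have b0 : 0 <= b by exact: leUr.
have xE : b = a - x by exact: vneg_part.
have [->|a_neq0] := eqVneq a 0; first by rewrite normr0.
have na0 : 0 < `|a| by rewrite normr_gt0.
(* M makes the norm of M *: a dominate that of b, and is at least 1. *)
pose M := 1 + `|b| / `|a|.
have M1 : 1 <= M by rewrite lerDl divr_ge0.
have M0 : 0 <= M by apply: le_trans M1.
have Mb : `|b| <= `|M *: a|.
  by rewrite normrZ ger0_norm // mulrDl mul1r divfK ?lerDr// gt_eqF.
have Ma0 : 0 <= M *: a by rewrite -(scaler0 _ M) vlerZ.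
(* As M *: a and b are disjoint, their sum is at most their join. *)
pose j := Order.join (M *: a) b.
have jE : M *: a + b <= j.
  rewrite -vsubr_ge0 -vlerN2 oppr0 opprB; apply: (vdisjoint_parts M1 (x := x)).
    by rewrite vlerBlDr vlerD// leUr.
  by rewrite vlerBlDr [leLHS]addrC vlerD// leUl.
have le1 : `|x + (M *: a + b)| = M * `|a| + `|a|.
  have -> : x + (M *: a + b) = (M + 1) *: a.
    by rewrite xE scalerDl scale1r addrCA [x + _]addrC subrK.
  by rewrite normrZ ger0_norm ?addr_ge0// mulrDl mul1r.
have le2 : `|M *: a + b| <= M * `|a|.
  have -> : M * `|a| = `|j|.
    rewrite /j Vmax// normrZ (ger0_norm M0) max_l//.
    by move: Mb; rewrite normrZ (ger0_norm M0).
  by apply: Vmono => //; rewrite -(addr0 0) vlerD.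
have := ler_normD x (M *: a + b); rewrite le1 => h.
by have := le_trans h (lerD (lexx _) le2); rewrite [leRHS]addrC lerD2l.
Qed.

(** The positive cone is closed because [l⁻ ≤ (u_n - l)⁺] as soon as
    [u_n ≥ 0], and taking positive parts does not increase the norm. *)
Lemma vge0_lim_am (R : realType) (V : banachVectorLatticeType R)
    (u : nat -> V) (l : V) :
  am_space V -> u @ \oo --> l -> (\forall n \near \oo, 0 <= u n) -> 0 <= l.
Proof.
move=> Vam ul u0.
suff nl : Order.join (- l) 0 = 0.
  by rewrite -vlerN2 oppr0 -nl leUl.
apply/eqP; rewrite -normr_eq0 eq_le normr_ge0 andbT.
apply/ler_addgt0Pr => eps eps0.
rewrite add0r.
have /cvgrPdist_lt/(_ _ eps0) ul' := ul.
near \oo => n.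
have un : 0 <= u n by near: n.
apply: (@le_trans _ _ `|l - u n|); last by apply/ltW; near: n.
rewrite distrC; apply: le_trans (norm_pospart_am (u n - l) Vam).
apply: Vam.1; first exact: leUr.
rewrite leUx leUr andbT; apply: le_trans (leUl _ _).
by rewrite -[leLHS]add0r vlerD2r.
Unshelve. all: by end_near.
Qed.

Lemma order_unit_ge0 (R : realType) (V : banachVectorLatticeType R) (e : V) :
  order_unit e -> 0 <= e.
Proof.
move=> /(_ e) [n [le_ne _]].
have : 0 <= e *+ n.+1 by rewrite -(vlerD2r (- (e *+ n))) add0r mulrS addrK.
move=> /(@vlerZ _ _ n.+1%:R^-1); rewrite invr_ge0 ler0n => /(_ isT).
by rewrite scaler0 -(scaler_nat _ e) scalerA mulVf ?pnatr_eq0// scale1r.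
Qed.

Lemma is_cvg_geometric_bounded (R : realType) (V : completeNormedModType R)
    (x : nat -> V) :
  (forall k, `|x k| <= 1) -> cvgn (series (fun k => 2^-1 ^+ k *: x k)).
Proof.
move=> x1; apply: normed_cvg.
apply: (series_le_cvg (v_ := geometric 1 2^-1)) => [n|n|n|].
- exact: normr_ge0.
- by rewrite /= mul1r exprn_ge0.
- rewrite /= mul1r normrZ normrX ger0_norm // ler_piMr// exprn_ge0//.
- by apply: is_cvg_geometric_series; rewrite ger0_norm// invf_lt1// ltr1n.
Qed.

(** A vector dominated by multiples of [e] is a pointwise notion; completeness
    makes it uniform on the unit ball.  Otherwise pick [x_k ≥ 0] in the unit
    ball with [x_k ≰ 4^k e].  The sum of the series [∑ 2^(-k) x_k] dominates
    each of its terms and lies below some [n e], so that [x_n ≤ 2^n n e ≤ 4^n e],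
    a contradiction. *)
Lemma order_unit_norm_bound (R : realType) (V : banachVectorLatticeType R)
    (e : V) :
  am_space V -> order_unit e ->
  exists2 C : R, 0 < C &
    forall x : V, `|x| <= 1 -> - (C *: e) <= x /\ x <= C *: e.
Proof.
move=> Vam Ve; have e0 := order_unit_ge0 Ve.
suff [C C0 CP] : exists2 C : R, 0 < C &
    forall x : V, 0 <= x -> `|x| <= 1 -> x <= C *: e.
  have ub (x : V) : `|x| <= 1 -> x <= C *: e.
    move=> x1; apply: le_trans (leUl x 0) _; apply: CP; first exact: leUr.
    exact: le_trans (norm_pospart_am x Vam) x1.
  exists C => // x x1; split; last exact: ub.
  by rewrite -vlerN2 opprK; apply: ub; rewrite normrN.
apply: contrapT => noC.
have /choice[x xP] : forall k : nat, exists x : V,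
    [/\ 0 <= x, `|x| <= 1 & ~ x <= 4 ^+ k *: e].
  move=> k; apply: contrapT => nox; apply: noC.
  exists (4 ^+ k); first by rewrite exprn_gt0.
  by move=> x x0 x1; apply: contrapT => xe; apply: nox; exists x.
pose u k := 2^-1 ^+ k *: x k.
have u0 k : 0 <= u k.
  by rewrite -(scaler0 _ (2^-1 ^+ k)) vlerZ ?exprn_ge0//; have [] := xP k.
have cu : cvgn (series u).
  by apply: is_cvg_geometric_bounded => k; have [] := xP k.
have u_le k : u k <= limn (series u).
  rewrite -vsubr_ge0; apply: (@vge0_lim_am _ _ (fun n => series u n - u k)) => //.
    by apply: cvgB => //; exact: cvg_cst.
  exists k.+1 => // n /= kn; rewrite vsubr_ge0 /series /=.
  rewrite (bigD1_seq k) ?iota_uniq ?mem_index_iota//= -[leLHS]addr0 vlerD//.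
  exact: vsumr_ge0.
(* The multiple n of e bounding the sum is also the index of the bad term. *)
have [n [_ len]] := Ve (limn (series u)).
have [_ _] := xP n; apply.
have -> : x n = 2 ^+ n *: u n.
  by rewrite /u scalerA -exprMn mulfV ?pnatr_eq0// expr1n scale1r.
apply: (@le_trans _ _ (2 ^+ n *: (e *+ n))).
  by rewrite vlerZ ?exprn_ge0//; apply: le_trans (u_le n) len.
rewrite -(scaler_nat _ e) scalerA vlerZ2//.
have -> : 4 = 2 * 2 :> R by rewrite -natrM.
rewrite exprMn ler_wpM2l ?exprn_ge0// -natrX ler_nat.
by apply: ltnW; exact: ltn_expl.
Qed.

(** * Group norms *)

Section GroupNorm.
Variables (R : realType) (X Y : completeNormedModType R).
Implicit Types A : nat -> nat -> {linear X -> Y}.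

Lemma group_norm_ge0 A n E : (0 <= group_norm A n E)%E.
Proof.
apply: ereal_sup_ubound; exists fset0, (fun=> 0); split => //.
- by move=> k; rewrite normr0.
- by rewrite big_seq_fset0 normr0.
Qed.

(** Homogeneity: divide the vectors by [M].  The inequality is one of extended
    reals, as the group norm may be infinite. *)
Lemma norm_sum_le_group_norm A n E (s : seq nat) (x : nat -> X) (M : R) :
  0 < M -> uniq s -> (forall k, k \in s -> E k) ->
  (forall k, k \in s -> `|x k| <= M) ->
  (`|\sum_(k <- s) A n k (x k)|%:E <= M%:E * group_norm A n E)%E.
Proof.
move=> M0 us sE sM.
pose F := [fset k in s]%fset.
pose y k := if k \in s then M^-1 *: x k else 0.
have -> : \sum_(k <- s) A n k (x k) = M *: \sum_(k <- F) A n k (y k).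
  have Fs : perm_eq F s by apply: uniq_perm => //= k; rewrite inE.
  rewrite (perm_big _ Fs) /= scaler_sumr; apply: eq_big_seq => k ks.
  by rewrite /y ks linearZ scalerA mulfV ?gt_eqF// scale1r.
rewrite normrZ gtr0_norm// EFinM lee_pmul2l ?lte_fin//.
apply: ereal_sup_ubound; exists F, y; split => //.
- by move=> k /=; rewrite !inE; exact: sE.
- move=> k; rewrite /y; case: ifPn => [ks|_]; last by rewrite normr0.
  by rewrite normrZ gtr0_norm ?invr_gt0// ler_pdivrMl// mulr1 sM.
Qed.

End GroupNorm.

(** * Limits along an ideal in terms of epsilons *)

Lemma ideal_lim_normP (R : realType) (V : completeNormedModType R)
    (I : set (set nat)) (x : nat -> V) (eta : V) : ideal_on_nat I ->
  ideal_lim I x eta <->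
  forall eps : R, 0 < eps -> I [set n | eps <= `|eta - x n|].
Proof.
move=> hI; split=> [h eps eps0|h U /nbhs_ballP[eps /= eps0 U_eps]].
  apply: (ideal_sub hI (h _ (nbhsx_ballx eta eps eps0))) => n /=.
  by rewrite -ball_normE /= => le_eps; apply/negP; rewrite -leNgt.
apply: (ideal_sub hI (h _ eps0)) => n /= nU.
rewrite leNgt; apply/negP => lt_eps; apply: nU; apply: U_eps.
by rewrite -ball_normE.
Qed.

Lemma ideal_lim_ereal0P (R : realType) (I : set (set nat)) (f : nat -> \bar R) :
  ideal_on_nat I -> (forall n, (0 <= f n)%E) ->
  ideal_lim I f 0%E <->
  forall eps : R, 0 < eps -> I [set n | (eps%:E <= f n)%E].
Proof.
move=> hI f0; split=> [h eps eps0|h U].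
  apply: (ideal_sub hI (h [set y | (y < eps%:E)%E] _)).
    apply: open_nbhs_nbhs; split; first exact: open_ereal_lt_ereal.
    by rewrite /= lte_fin.
  by move=> n /= le_eps; apply/negP; rewrite -leNgt.
(* A neighbourhood of a finite point is, by definition, one whose trace on the
   reals is a neighbourhood. *)
move=> nU; have /nbhs_ballP[eps /= eps0 U_eps] :
  nbhs (0 : R) (fun r => U r%:E) := nU.
apply: (ideal_sub hI (h _ eps0)) => n /= nUf.
rewrite leNgt; apply/negP => lt_eps; apply: nUf.
have := f0 n; move: lt_eps; case: (f n) => //= r.
rewrite lte_fin lee_fin => r_eps r0.
by apply: U_eps; rewrite -ball_normE /= sub0r normrN ger0_norm.
Qed.

(** * Group norm conditions imply regularity *)

Section Sufficiency.
Variables (R : realType) (X Y : completeNormedModType R).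
Implicit Types A : nat -> nat -> {linear X -> Y}.

(** The block [∑_(p ≤ k < q) A_(n,k) x_k] is at most [M ‖A_(n,≥p)‖], so the
    tail condition is the Cauchy criterion. *)
Lemma is_cvg_mx_series A n (x : nat -> X) (M : R) :
  group_norm A n [set j | (k <= j)%N] @[k --> \oo] --> 0%E ->
  0 < M -> (forall k, `|x k| <= M) -> cvgn (mx_series A x n).
Proof.
move=> tail M0 xM; apply/cauchy_cvgP/cauchy_seriesP => eps eps0.
have [K _ tailK] : \forall k \near \oo,
    (group_norm A n [set j | (k <= j)%N] < (eps / M)%:E)%E.
  apply: (tail [set y | (y < (eps / M)%:E)%E]).
  apply: open_nbhs_nbhs; split; first exact: open_ereal_lt_ereal.
  by rewrite /= lte_fin divr_gt0.
exists ([set k | (K <= k)%N], [set k | (K <= k)%N]); first by split; exists K.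
move=> [p q] /= [Kp Kq].
rewrite -lte_fin.
apply: (@le_lt_trans _ _
  (M%:E * group_norm A n [set j | (K <= j)%N])%E).
  apply: norm_sum_le_group_norm => //; first exact: iota_uniq.
  by move=> k; rewrite mem_index_iota => /andP[pk _] /=; exact: leq_trans pk.
rewrite -lte_pdivlMl// -EFinM mulrC; apply: tailK => /=; exact: leqnn.
Qed.

Lemma norm_limn_le (u : nat -> Y) (M : R) :
  cvgn u -> (forall n, `|u n| <= M) -> `|limn u| <= M.
Proof.
move=> cu uM; have cn : `|u n| @[n --> \oo] --> `|limn u| by exact: cvg_norm.
rewrite -(cvg_lim (@Rhausdorff R) cn); apply: limr_le; first exact: cvgP cn.
by apply: nearW.
Qed.

(** Split each partial sum into the indices in [E], where [x] is only bounded,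
    and the others, where it is small. *)
Lemma mx_apply_le A n (x : nat -> X) (E : set nat) (M S G d : R) :
  cvgn (mx_series A x n) -> 0 < M -> 0 < d ->
  (group_norm A n setT <= S%:E)%E -> (group_norm A n E <= G%:E)%E ->
  (forall k, `|x k| <= M) -> (forall k, ~ E k -> `|x k| <= d) ->
  `|mx_apply A x n| <= M * G + d * S.
Proof.
move=> cx M0 d0 AS AG xM xd; apply: norm_limn_le => // N.
rewrite /mx_series /series /= (bigID (fun k => `[< E k >])) /=.
rewrite -big_filter -[X in _ + X]big_filter.
apply: le_trans (ler_normD _ _) _; apply: lerD; rewrite -lee_fin EFinM.
  apply: (@le_trans _ _ (M%:E * group_norm A n E)%E).
    apply: norm_sum_le_group_norm => //; first by rewrite filter_uniq ?iota_uniq.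
    by move=> k; rewrite mem_filter => /andP[/asboolP].
  by rewrite lee_pmul2l ?lte_fin.
apply: (@le_trans _ _ (d%:E * group_norm A n setT)%E).
  apply: norm_sum_le_group_norm => //; first by rewrite filter_uniq ?iota_uniq.
  by move=> k; rewrite mem_filter => /andP[/asboolPn]; auto.
by rewrite lee_pmul2l ?lte_fin.
Qed.

Lemma cb_bound (I : set (set nat)) (x : nat -> X) :
  cb I x -> exists2 M : R, 0 < M & forall k, `|x k| <= M.
Proof.
move=> [/pinfty_ex_gt0[M M0 xM] _]; exists M => // k; exact: xM.
Qed.

(** By linearity [T η - A_n x] is the row sum error [T η - ∑_k A_(n,k) η] plus
    [A_n (η - x)], to which [mx_apply_le] applies with [E] the set of indices
    where [x_k] is not close to [η]. *)
Lemma regular_of_group_norm (I J : set (set nat)) (T : {linear X -> Y}) A :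
  ideal_on_nat I -> ideal_on_nat J ->
  (forall n, group_norm A n [set j | (k <= j)%N] @[k --> \oo] --> 0%E) ->
  (ereal_sup (range (fun n => group_norm A n setT)) < +oo)%E ->
  ideal_lim_row_sums J A T ->
  (forall E : set nat, I E -> ideal_lim J (fun n => group_norm A n E) 0%E) ->
  regular I J T A.
Proof.
move=> hI hJ tail sup_lty [cT limT] limE.
have [S S0 AS] : exists2 S : R,
    0 < S & forall n, (group_norm A n setT <= S%:E)%E.
  set s := ereal_sup _ in sup_lty.
  have s_ub n : (group_norm A n setT <= s)%E.
    by apply: ereal_sup_ubound; exists n.
  have s0 : (0 <= s)%E by apply: le_trans (s_ub 0%N); exact: group_norm_ge0.
  exists (fine s + 1) => [|n]; first by rewrite ltr_wpDl// fine_ge0.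
  rewrite (le_trans (s_ub n))// EFinD fineK ?ge0_fin_numE//.
  by rewrite leeDl.
have cA (x : nat -> X) (M : R) n : 0 < M -> (forall k, `|x k| <= M) ->
    cvgn (mx_series A x n).
  by move=> M0; exact: is_cvg_mx_series.
have lim_cb (x : nat -> X) (eta : X) : cb I x -> ideal_lim I x eta ->
    ideal_lim J (mx_apply A x) (T eta).
  move=> xcb /(ideal_lim_normP _ _ hI) xeta; have [M M0 xM] := cb_bound xcb.
  apply/(ideal_lim_normP _ _ hJ) => eps eps0.
  pose z k := eta - x k; pose N := `|eta| + M.
  have N0 : 0 < N by rewrite ltr_wpDl.
  have zN k : `|z k| <= N by rewrite (le_trans (ler_normB _ _))// lerD2l.
  (* d and eps / (4 * N) below make the two terms of mx_apply_le at most a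
     quarter of eps each; the other half is left to the row sums. *)
  pose d := eps / (4 * S); have d0 : 0 < d by rewrite divr_gt0// mulr_gt0.
  pose E := [set k | d <= `|eta - x k|].
  have IE : I E by exact: xeta.
  have /(ideal_lim_normP _ _ hJ) limeta := limT eta.
  have /(ideal_lim_ereal0P hJ (fun n => group_norm_ge0 A n E)) limG := limE E IE.
  have eps2 : 0 < eps / 2 by rewrite divr_gt0.
  have eps4 : 0 < eps / (4 * N) by rewrite divr_gt0// mulr_gt0.
  apply: (ideal_sub hJ (ideal_setU hJ (limeta _ eps2) (limG _ eps4))).
  move=> n /= le_eps; apply: contrapT => /not_orP[/negP].
  rewrite -ltNge => lt2 /negP; rewrite -ltNge => lt4.
  have zE :
      limn (series (fun k => A n k eta)) - mx_apply A x n = mx_apply A z n.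
    apply/esym/cvg_lim => //; rewrite /mx_series /z.
    have -> : series (fun k => A n k (eta - x k)) =
        series (fun k => A n k eta) - mx_series A x n.
      apply/funext => m; rewrite /series /mx_series/= fctE -sumrB.
      by apply: eq_bigr => k _; rewrite linearB.
    by apply: cvgB; [exact: cT | exact: cA xM].
  have Az : `|mx_apply A z n| <= N * (eps / (4 * N)) + d * S.
    apply: (@mx_apply_le A n z E N S) => //; [exact: cA zN|exact: ltW|].
    by move=> k /negP; rewrite -ltNge => /ltW.
  move: le_eps; apply/negP; rewrite -ltNge.
  have -> : T eta - mx_apply A x n =
      (T eta - limn (series (fun k => A n k eta))) + mx_apply A z n.
    by rewrite -zE addrA subrK.
  apply: le_lt_trans (ler_normD _ _) _.
  have -> : eps = eps / 2 + (N * (eps / (4 * N)) + d * S).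
    by rewrite /d; field; rewrite !gt_eqF.
  by apply: ltr_leD.
split=> // x xcb; have [M M0 xM] := cb_bound xcb.
split=> [n|]; first exact: cA xM.
split.
  exists (M * S + 1 * S); split; first exact: num_real.
  move=> B MB n _; apply: le_trans (ltW MB).
  (* With E the full set the smallness requirement is vacuous; d is then any
     positive number. *)
  apply: (@mx_apply_le A n x setT M S S 1) => //; first exact: cA M0 xM.
  by move=> k; case.
have [_ [eta xeta]] := xcb; exists (T eta); exact: lim_cb.
Qed.

End Sufficiency.

(** * Positive operators and regularity *)

Lemma norm_le_banach_lattice (R : realType) (V : banachVectorLatticeType R)
    (x y : V) :
  banach_lattice V -> - y <= x -> x <= y -> `|x| <= `|y|.
Proof.
move=> hV yx xy; apply: hV; apply: le_trans (leUl y (- y)).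
by rewrite leUx xy -vlerN2 opprK.
Qed.

(** Positivity bounds [±∑_(k ∈ F) A_(n,k) x_k] by [C ∑_(k ∈ F) A_(n,k) e], and
    adding the positive terms of [E] outside [F] only enlarges this.  The
    comparison of norms is made with partial sums, long enough to contain [F],
    and passes to the limit. *)
Lemma group_norm_le_mx_apply (R : realType) (X Y : banachVectorLatticeType R)
    (e : X) (C : R) (A : nat -> nat -> {linear X -> Y}) (n : nat) (E : set nat) :
  banach_lattice Y -> 0 < C -> 0 <= e ->
  (forall x : X, `|x| <= 1 -> - (C *: e) <= x /\ x <= C *: e) ->
  (forall k, positive_operator (A n k)) ->
  cvgn (mx_series A (fun k => if `[< E k >] then e else 0) n) ->
  (group_norm A n E <=
   (C * `|mx_apply A (fun k => if `[< E k >] then e else 0) n|)%:E)%E.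
Proof.
move=> hY C0 e0 Ce Apos; set v := fun k => _ => cv.
have Amono k (x y : X) : x <= y -> A n k x <= A n k y.
  by rewrite -vsubr_ge0 => /(Apos k); rewrite linearB vsubr_ge0.
have v0 k : 0 <= v k by rewrite /v; case: ifP.
apply: ge_ereal_sup => _ [F [x [FE x1 ->]]].
rewrite lee_fin -ler_pdivrMl//.
have cn : `|mx_series A v n N| @[N --> \oo] --> `|mx_apply A v n|.
  exact: cvg_norm.
rewrite -(cvg_lim (@Rhausdorff R) cn); apply: limr_ge; first exact: cvgP cn.
exists (\max_(k <- F) k).+1 => // N /= FN.
rewrite ler_pdivrMl// -[X in X * _](gtr0_norm C0) -normrZ.
have FNk k : k \in (F : seq nat) -> (k < N)%N.
  by move=> kF; apply: leq_trans FN; rewrite ltnS; exact: leq_bigmax_seq.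
have sumF : \sum_(k <- F) A n k (C *: e) <= C *: mx_series A v n N.
  rewrite /mx_series /series /= scaler_sumr.
  rewrite [leRHS](bigID (fun k => k \in F)) /=.
  have FP : perm_eq F [seq k <- index_iota 0 N | k \in F].
    apply: uniq_perm; [exact: fset_uniq|by rewrite filter_uniq ?iota_uniq|].
    move=> k; rewrite mem_filter mem_index_iota.
    by case: (boolP (k \in _)) => // /FNk ->.
  rewrite -[X in X + _]big_filter -(perm_big _ FP) /=.
  rewrite -[leLHS]addr0 vlerD//.
    rewrite big_seq [leRHS]big_seq; apply: vsumr_le => k kF.
    by rewrite /v asboolT ?linearZ//; exact: FE.
  apply: vsumr_ge0 => k _; rewrite -(scaler0 _ C).
  by apply: vlerZ; [exact: ltW | exact: Apos].
apply: norm_le_banach_lattice hY _ _; last first.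
  apply: le_trans sumF; apply: vsumr_le => k _; apply: Amono.
  by have [] := Ce _ (x1 k).
rewrite -[leRHS]opprK vlerN2; apply: le_trans sumF.
rewrite -sumrN; apply: vsumr_le => k _; rewrite -linearN; apply: Amono.
by rewrite -[leRHS]opprK vlerN2; have [] := Ce _ (x1 k).
Qed.

Theorem theorem2p10 (R : realType) (X Y : banachVectorLatticeType R)
    (hX : am_space X) (hY : banach_lattice Y) (e : X) (he : order_unit e) (T : {linear X -> Y}) (I J : set (set nat))
    (hI : ideal_on_nat I) (hJ : ideal_on_nat J)
    (A : nat -> nat -> {linear X -> Y})
    (hpos : forall n k, positive_operator (A n k))
    (htail : forall n : nat,
       group_norm A n [set j | (k <= j)%N] @[k --> \oo] --> 0%E) :
  regular I J T A <->
  [/\ (ereal_sup (range (fun n => group_norm A n setT)) < +oo)%E,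
      ideal_lim_row_sums J A T
    & forall E : set nat, I E -> ideal_lim J (fun n => group_norm A n E) 0%E].
Proof.
split; last by move=> [T1 T4 T6]; exact: regular_of_group_norm.
move=> [clsA limA].
have [C C0 Ce] := order_unit_norm_bound hX he.
have e0 := order_unit_ge0 he.
have cst_cb x : cb I (fun=> x : X) /\ ideal_lim I (fun=> x : X) x.
  have limx : ideal_lim I (fun=> x : X) x.
    move=> U Ux; apply: (ideal_finite hI); rewrite (_ : [set _ | _] = set0)//.
    by apply/seteqP; split=> // k /=; apply; exact: nbhs_singleton.
  split=> //; split; last by exists x.
  by exists `|x|; split; [exact: num_real | move=> M xM k _; exact: ltW].
pose v (E : set nat) k := if `[< E k >] then e else 0.
split.
- have vT : v setT = fun=> e by apply/funext => k; rewrite /v asboolT.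
  have [cA /cb_bound[M M0 AM]] := clsA _ (cst_cb e).1.
  apply: (@le_lt_trans _ _ (C * M)%:E); last exact: ltry.
  apply: ge_ereal_sup => _ [n _ <-].
  apply: le_trans (group_norm_le_mx_apply hY C0 e0 Ce (hpos n) _) _.
    by rewrite -/(v setT) vT; exact: cA.
  by rewrite -/(v setT) vT lee_fin ler_pM2l.
- split=> [x n|x]; first by have [cA _] := clsA _ (cst_cb x).1; exact: cA.
  by have [xcb xlim] := cst_cb x; exact: limA.
- move=> E IE.
  have limv : ideal_lim I (v E) 0.
    move=> U U0; apply: (ideal_sub hI IE) => k /= nU; apply: contrapT => nE.
    by apply: nU; rewrite /v asboolF//; exact: nbhs_singleton.
  have vcb : cb I (v E).
    split; last by exists 0.
    exists `|e|; split; first exact: num_real.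
    move=> M eM k _; apply: le_trans (ltW eM).
    by rewrite /v; case: ifP => // _; rewrite normr0.
  have [cA _] := clsA _ vcb.
  have := limA _ _ vcb limv; rewrite linear0 => /(ideal_lim_normP _ _ hJ) limAv.
  apply/(ideal_lim_ereal0P hJ (fun n => group_norm_ge0 A n E)) => eps eps0.
  apply: (ideal_sub hJ (limAv _ (divr_gt0 eps0 C0))) => n /= le_eps.
  rewrite sub0r normrN ler_pdivrMr// mulrC -lee_fin.
  apply: le_trans le_eps _; apply: group_norm_le_mx_apply => //; exact: cA.
Qed.
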